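(* Let $A$ be a real $m\times n$ matrix, $b\in\mathbb{R}^m$, $c\in\mathbb{R}^n$, and let $P\equiv\min\{c^\top x\mid Ax=b,\ x\in\mathbb{R}^n_+\}$ be feasible with finite optimal value $v(P)$. Let $T$ be a $k\times m$ (projection) matrix with $k<m$, and let $P_T\equiv\min\{c^\top x\mid TAx=Tb,\ x\in\mathbb{R}^n_+\}$ have finite optimal value $v(P_T)=v(P)-\nu$, where $0\le\nu\le\delta$ for some given $\delta>0$. Put $$\tilde A=\begin{pmatrix}c^\top\\ A\end{pmatrix},\qquad \tilde b=\begin{pmatrix}v(P)-\nu\\ b\end{pmatrix},\qquad \tilde T=\begin{pmatrix}1&0\\0&T\end{pmatrix},\qquad F'=\{x\in\mathbb{R}^n_+\mid\tilde T\tilde Ax=\tilde T\tilde b\}.$$ Assume that $\mathrm{cone}(A)$ is full dimensional in $\mathbb{R}^m$ and that any optimal solution of $P$ has at least $m$ non-zero components. Let $x'$ be chosen uniformly in $F'$. Then, almost surely, $\tilde Ax'=\tilde b$ does not hold.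
   Context: $\mathrm{cone}(A)$ is the set of nonnegative linear combinations of the columns of $A$. $F'$ is the set of optimal solutions of $P_T$. The matrix $T$ is a fixed realization of a random projection matrix; the probability is with respect to the choice of $x'$. ''Uniformly in $F'$'' means distributed according to normalized Lebesgue measure (on the affine hull of $F'$) restricted to the polyhedron $F'$, which is assumed bounded so that this distribution makes sense. *)

(* Defs.v *)
From HB Require Import structures.
From mathcomp Require Import all_boot all_order all_algebra.
From mathcomp Require Import all_classical all_reals all_analysis.

Set Implicit Arguments.
Unset Strict Implicit.
Unset Printing Implicit Defensive.

Import Order.TTheory GRing.Theory Num.Theory.
Import numFieldNormedType.Exports.

Local Open Scope classical_set_scope.
Local Open Scope ring_scope.

Section linear_programs.
Context {R : realType} {m n : nat}.
Implicit Types (A : 'M[R]_(m, n)) (b : 'cV[R]_m) (c x : 'cV[R]_n).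

Definition nonneg_vec x : Prop := forall i, 0 <= x i 0.

Definition objective c x : R := (c^T *m x) 0 0.

Definition feasible A b : set 'cV[R]_n := [set x | A *m x = b /\ nonneg_vec x].

(* +oo when the program is infeasible, -oo when it is unbounded; a finite
   value is attained, so that "inf" and "min" agree. *)
Definition lp_value c A b : \bar R :=
  ereal_inf [set (objective c x)%:E | x in feasible A b].

Definition lp_optimal c A b : set 'cV[R]_n :=
  [set x | feasible A b x /\
           forall y, feasible A b y -> objective c x <= objective c y].

Definition nb_nonzero x : nat := #|[set i | x i 0 != 0]%SET|.

Definition cone A : set 'cV[R]_m := [set A *m x | x in nonneg_vec].

End linear_programs.

Section affine_hull.
Context {R : realType} {n : nat}.
Implicit Types S : set 'cV[R]_n.

Definition affine_hull S : set 'cV[R]_n :=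
  [set x | exists (N : nat) (s : 'I_N -> 'cV[R]_n) (l : 'I_N -> R),
    [/\ forall i, S (s i), \sum_i l i = 1 & x = \sum_i l i *: s i]].

(* The dimension of a convex set is that of its affine hull. *)
Definition full_dimensional S : Prop := affine_hull S = setT.

End affine_hull.

(* In dimension 0 this is the Dirac mass at the unique point. *)
Fixpoint lebesgue_tuple (R : realType) (d : nat) :
    set (d.-tuple (measurableTypeR R)) -> \bar R :=
  match d with
  | 0 => dirac [tuple]
  | d'.+1 => pushforward (@lebesgue_measure R \x lebesgue_tuple (d := d'))%E
               (fun p => [tuple of p.1 :: p.2])
  end.

Definition borel_cV (R : realType) (n : nat) :=
  g_sigma_algebraType (@open 'cV[R]_n).

Section uniform_distribution.
Context {R : realType} {n : nat}.

Definition affine_map d (p : 'cV[R]_n) (Q : 'M[R]_(n, d))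
    (u : d.-tuple (measurableTypeR R)) : 'cV[R]_n :=
  p + Q *m \col_i tnth u i.

(* When Q has orthonormal columns, u |-> p + Q u is an isometry of R^d onto its
   range, and this is the d-dimensional Lebesgue measure of that range. *)
Definition affine_lebesgue d (p : 'cV[R]_n) (Q : 'M[R]_(n, d))
    (B : set 'cV[R]_n) : \bar R :=
  lebesgue_tuple (affine_map p Q @^-1` B).

(* mu is the restriction to S of the Lebesgue measure on the affine hull of S,
   normalized. The right-hand side does not depend on the isometric
   parametrization (p, Q) of the affine hull. If S has measure 0 or +oo then
   mu = 0 (with x / 0 = x * +oo and x / +oo = 0 in \bar R), so no probability
   measure is uniform on such an S. *)
Definition uniform_on (S : set 'cV[R]_n)
    (mu : set (borel_cV R n) -> \bar R) : Prop :=
  exists (d : nat) (p : 'cV[R]_n) (Q : 'M[R]_(n, d)),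
    [/\ Q^T *m Q = 1%:M,
        affine_hull S = range (affine_map p Q) &
        forall B : set (borel_cV R n), measurable B ->
          mu B = (affine_lebesgue p Q (B `&` S) / affine_lebesgue p Q S)%E].

End uniform_distribution.

(* Main.v *)
(* If a point of F' satisfies Ax = b, then nu = 0 and that point is optimal for P,
   so P has an optimal solution y of minimal support; A is injective on the
   coordinate space spanned by that support, which has dimension at least m > k.
   Hence some direction w <> 0 supported there has TAw = 0 and Aw <> 0. Both
   y + tw and y - tw are feasible for P_T for small t > 0, and y is optimal for
   P_T because nu = 0, so w does not change the objective: y + tw lies in F' but
   not in {Ax = b}. Thus {Ax = b} cuts the affine hull of F' in a proper affine
   subspace, which is Lebesgue-null. *)
Require Import Defs.
From HB Require Import structures.
From mathcomp Require Import all_boot all_order all_algebra.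
From mathcomp Require Import all_classical all_reals all_analysis.

Set Implicit Arguments.
Unset Strict Implicit.
Unset Printing Implicit Defensive.

Import Order.TTheory GRing.Theory Num.Theory.
Import numFieldNormedType.Exports.
(* Without this import [\bar R] has no canonical sigma-algebra. *)
Import measurable_realfun.

Local Open Scope classical_set_scope.
Local Open Scope ring_scope.

(** * Feasible directions and optimal solutions of minimal support *)

(** The ratio test: [e] is the least [x i 0 / |v i 0|] over the support of [v], so no coordinate
    turns negative for [|t| <= e], and a minimizing coordinate vanishes at one of the two ends. *)
Lemma support_perturbation (R : realType) (n : nat) (x v : 'cV[R]_n) :
  nonneg_vec x -> v != 0 -> (forall i, x i 0 = 0 -> v i 0 = 0) ->
  exists e : R,
    [/\ 0 < e, forall t, `|t| <= e -> nonneg_vec (x + t *: v) &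
      exists2 t, `|t| <= e & (nb_nonzero (x + t *: v) < nb_nonzero x)%N].
Proof.
move=> x0 vN0 supp.
have [j vj] : exists j, v j 0 != 0.
  by case/cV0Pn: vN0 => j; exists j.
have [i vi min_i] :=
  arg_minP (P := fun i => v i 0 != 0) (fun i => x i 0 / `|v i 0|) vj.
have xi : 0 < x i 0.
  rewrite lt_neqAle x0 andbT eq_sym; apply: contra vi => /eqP /supp ->.
  by rewrite eqxx.
have vi0 : 0 < `|v i 0| by rewrite normr_gt0.
exists (x i 0 / `|v i 0|); split.
- exact: divr_gt0.
- move=> t te l; rewrite !mxE.
  have [vl|vl] := eqVneq (v l 0) 0; first by rewrite vl mulr0 addr0.
  have : `|t * v l 0| <= x l 0.
    rewrite normrM -ler_pdivlMr ?normr_gt0 //.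
    exact: le_trans te (min_i _ vl).
  by rewrite ler_norml => /andP[+ _]; rewrite -subr_ge0 opprK addrC.
(* This end is the one where coordinate [i] cancels; zeros of [x] stay zero since [v] vanishes
   there. *)
exists (- (x i 0 / v i 0)).
  by rewrite normrN normf_div (ger0_norm (x0 i)).
apply: proper_card; apply/properP; split.
  apply/fintype.subsetP => l; rewrite !inE.
  rewrite !mxE; apply: contra => /eqP xl.
  by rewrite xl (supp _ xl) mulr0 addr0.
exists i; first by rewrite inE gt_eqF.
by rewrite inE !mxE mulNr divfK // subrr eqxx.
Qed.

Lemma objective_perturbation (R : realType) (n : nat) (c x v : 'cV[R]_n)
    (t : R) :
  objective c (x + t *: v) = objective c x + t * objective c v.
Proof. by rewrite /objective mulmxDr -scalemxAr !mxE. Qed.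

(** Optimality against both [x + e *: v] and [x - e *: v] bounds [objective c v] by 0 from both
    sides. *)
Lemma optimal_feasible_direction (R : realType) (n m : nat) (A : 'M[R]_(m, n))
    (b : 'cV[R]_m) (c x v : 'cV[R]_n) (e : R) :
  lp_optimal c A b x -> A *m v = 0 -> 0 < e ->
  (forall t, `|t| <= e -> nonneg_vec (x + t *: v)) -> objective c v = 0.
Proof.
move=> [[Axb _] opt] Av e0 xe.
have le_t t : `|t| <= e -> 0 <= t * objective c v.
  move=> te; rewrite -(lerDl (objective c x)) -objective_perturbation.
  apply: opt; split; last exact: xe.
  by rewrite mulmxDr -scalemxAr Av scaler0 addr0.
apply/eqP; rewrite eq_le; apply/andP; split.
  have := le_t (- e); rewrite normrN gtr0_norm // => /(_ (lexx _)).
  by rewrite mulNr oppr_ge0 pmulr_rle0.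
have := le_t e; rewrite gtr0_norm // => /(_ (lexx _)).
by rewrite pmulr_rge0.
Qed.

(** Descent on the support size: a nonzero kernel direction inside the support keeps the objective
    constant, so it can be followed until a coordinate vanishes. *)
Lemma exists_basic_optimal (R : realType) (n m : nat) (A : 'M[R]_(m, n))
    (b : 'cV[R]_m) (c x : 'cV[R]_n) :
  lp_optimal c A b x ->
  exists2 y, lp_optimal c A b y &
    forall v : 'cV[R]_n,
      A *m v = 0 -> (forall i, y i 0 = 0 -> v i 0 = 0) -> v = 0.
Proof.
have [N] := ubnP (nb_nonzero x); elim: N x => // N IH x xN xopt.
have [|] := pselect (forall v : 'cV[R]_n, A *m v = 0 ->
  (forall i, x i 0 = 0 -> v i 0 = 0) -> v = 0); first by exists x.
move=> /existsNP[v /not_implyP[Av /not_implyP[supp /eqP v0]]].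
have [e [e0 xe [t te tlt]]] := support_perturbation xopt.1.2 v0 supp.
apply: (IH (x + t *: v)); first exact: leq_trans tlt _.
have cv := optimal_feasible_direction xopt Av e0 xe.
split; first split.
- by rewrite mulmxDr -scalemxAr Av scaler0 addr0 xopt.1.1.
- exact: xe.
- by move=> y /xopt.2; rewrite objective_perturbation cv mulr0 addr0.
Qed.

Lemma exists_kernel_in_support (R : realType) (n k : nat) (B : 'M[R]_(k, n))
    (x : 'cV[R]_n) :
  (k < nb_nonzero x)%N ->
  exists v : 'cV[R]_n, [/\ v != 0, B *m v = 0 & forall i, x i 0 = 0 -> v i 0 = 0].
Proof.
rewrite /nb_nonzero; set S := [set i | _]%SET => kS.
(* [r *m E] spreads [r] over the coordinates in [S] and is zero elsewhere. *)
pose E : 'M[R]_(#|S|, n) := rowsub (fun i : 'I_#|S| => enum_val i) 1%:M.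
have Einj (r : 'rV_#|S|) : r *m E = 0 -> r = 0.
  move=> rE; apply/rowP => i; have /rowP/(_ (enum_val i)) := rE.
  rewrite !mxE (bigD1 i) //= !mxE eqxx mulr1 big1 ?addr0 // => j ji.
  by rewrite !mxE (inj_eq enum_val_inj) (negbTE ji) mulr0.
(* There are [#|S|] rows but only [k < #|S|] columns, so the rows are dependent. *)
have : kermx (E *m B^T) != 0.
  rewrite kermx_eq0 /row_free ltn_eqF //.
  exact: leq_ltn_trans (rank_leq_col _) kS.
move=> /rowV0Pn[r /sub_kermxP rEB r0].
exists (r *m E)^T; split.
- by rewrite -trmx0 (inj_eq trmx_inj); apply: contra r0 => /eqP/Einj ->.
- by apply: trmx_inj; rewrite trmx_mul trmxK trmx0 -mulmxA.
move=> i xi; rewrite !mxE big1 // => j _; rewrite !mxE.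
case: eqP => [ji|]; last by rewrite mulr0.
by have := enum_valP j; rewrite ji inE xi eqxx.
Qed.

Lemma lp_value_lb (R : realType) (n m : nat) (A : 'M[R]_(m, n)) (b : 'cV[R]_m)
    (c : 'cV[R]_n) (v : R) (x : 'cV[R]_n) :
  lp_value c A b = v%:E -> feasible A b x -> v <= objective c x.
Proof.
move=> val xf; rewrite -lee_fin -val; apply: ereal_inf_lbound.
by exists x.
Qed.

(** This is the case [nu = 0], where both programs have value [v]; it supplies the point of [F']
    outside the original affine subspace. *)
Lemma projected_optimal_off_original (R : realType) (m n k : nat)
    (A : 'M[R]_(m, n)) (b : 'cV[R]_m) (c : 'cV[R]_n) (T : 'M[R]_(k, m))
    (v : R) :
  (k < m)%N -> lp_value c A b = v%:E ->
  lp_value c (T *m A) (T *m b) = v%:E ->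
  (forall x, lp_optimal c A b x -> (m <= nb_nonzero x)%N) ->
  forall x, feasible A b x -> objective c x = v ->
  exists y, [/\ feasible (T *m A) (T *m b) y, objective c y = v & A *m y <> b].
Proof.
move=> km valP valPT supp x xf cx.
have [y yopt yinj] : exists2 y, lp_optimal c A b y &
    forall v : 'cV[R]_n,
      A *m v = 0 -> (forall i, y i 0 = 0 -> v i 0 = 0) -> v = 0.
  apply: (@exists_basic_optimal _ _ _ _ _ _ x); split=> // z zf.
  by rewrite cx; exact: lp_value_lb valP zf.
have cy : objective c y = v.
  apply/eqP; rewrite eq_le (lp_value_lb valP yopt.1) andbT -cx.
  exact: yopt.2.
have [w [w0 TAw wsupp]] :=
  exists_kernel_in_support (T *m A) (leq_trans km (supp _ yopt)).
have [e [e0 ye _]] := support_perturbation yopt.1.2 w0 wsupp.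
have yoptT : lp_optimal c (T *m A) (T *m b) y.
  split; first by split; [rewrite -mulmxA yopt.1.1|exact: yopt.1.2].
  by move=> z zf; rewrite cy; exact: lp_value_lb valPT zf.
have cw := optimal_feasible_direction yoptT TAw e0 ye.
exists (y + e *: w); split.
- split; last by apply: ye; rewrite gtr0_norm.
  by rewrite mulmxDr -scalemxAr TAw scaler0 addr0 yoptT.1.1.
- by rewrite objective_perturbation cw mulr0 addr0.
rewrite mulmxDr -scalemxAr yopt.1.1 => /eqP.
rewrite -[X in _ == X]addr0 (inj_eq (addrI _)) scaler_eq0 gt_eqF //= => /eqP Aw.
by move: w0; rewrite (yinj w Aw wsupp) eqxx.
Qed.

(** * Lebesgue-null affine subspaces *)

(** Off [x0] the function is zero, hence measurable there, so the null point can be removed from the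
    domain. *)
Lemma integral_lebesgue_off_point (R : realType) (f : R -> \bar R) (x0 : R) :
  (forall x, x != x0 -> f x = 0%E) ->
  (\int[@lebesgue_measure R]_x f x = 0)%E.
Proof.
move=> f0; rewrite -(@integral_setD1 _ f x0).
- by apply: integral0_eq => x [_ /eqP]; exact: f0.
- by apply: measurableD.
apply: (eq_measurable_fun (cst 0%E)) => // x; rewrite inE => -[_ /eqP xx0].
by rewrite f0.
Qed.

(** Induction on [d], slicing along the first coordinate: all slices but at most one satisfy a
    nondegenerate equation again. The disjunct [beta != 0] admits zero coefficients, where the
    equation has no solution; dimension 0 relies on it. *)
Lemma lebesgue_tuple_hyperplane (R : realType) (d : nat) (a : 'I_d -> R)
    (beta : R) (X : set (d.-tuple (measurableTypeR R))) :
  (forall u, X u -> \sum_i a i * tnth u i = beta) ->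
  (exists i, a i != 0) \/ beta != 0 ->
  lebesgue_tuple X = 0%E.
Proof.
elim: d a beta X => [|d IH] a beta X Xsub nz /=.
  have {}nz : beta != 0 by case: nz => [[[]]|].
  rewrite (_ : X = set0) ?measure0 //.
  rewrite -subset0 => u /Xsub; rewrite big_ord0 => /esym/eqP.
  exact/negP.
rewrite /pushforward /product_measure1.
(* Only at [x0] can the sliced equation become [0 = 0]. If [a ord0] is zero, no slice degenerates
   and the value of [x0] is immaterial. *)
pose x0 := beta / a ord0.
apply: (@integral_lebesgue_off_point _ _ x0) => x xx0 /=.
apply: (IH (fun i => a (lift ord0 i)) (beta - a ord0 * x)).
  move=> u; rewrite /xsection /= inE /= => /Xsub.
  rewrite big_ord_recl tnth0 => <-; rewrite addrC addKr.
  by apply: eq_bigr => i _; rewrite tnthS.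
have [[i ai]|tail0] := pselect (exists i, a (lift ord0 i) != 0).
  by left; exists i.
right; rewrite subr_eq0.
have [a0|a0] := eqVneq (a ord0) 0.
  rewrite a0 mul0r; case: nz => // -[i]; case: (unliftP ord0 i) => [j ->|->].
    by move=> aj; case: tail0; exists j.
  by rewrite a0 eqxx.
apply: contra xx0 => /eqP betaE; apply/eqP.
by rewrite /x0 betaE mulrC mulKf.
Qed.

(** Some row of the system fails at a point of the range; pulled back to the parameters, that row is
    a nondegenerate linear equation. *)
Lemma affine_lebesgue_proper (R : realType) (m n d : nat) (p : 'cV[R]_n)
    (Q : 'M[R]_(n, d)) (A : 'M[R]_(m, n)) (b : 'cV[R]_m) (E : set 'cV[R]_n) :
  (forall x, E x -> A *m x = b) ->
  (exists2 y, range (affine_map p Q) y & A *m y <> b) ->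
  affine_lebesgue p Q E = 0%E.
Proof.
move=> EA [y [u0 _ <-] Ay].
have [i Ai] : exists i, (A *m affine_map p Q u0) i 0 != b i 0.
  apply: contrapT => /forallNP H; apply: Ay; apply/colP => i.
  by have /negP := H i; rewrite negbK => /eqP.
have coordE u : (A *m affine_map p Q u) i 0 =
    (A *m p) i 0 + \sum_j (A *m Q) i j * tnth u j.
  rewrite /affine_map mulmxDr mulmxA mxE; congr (_ + _).
  by rewrite mxE; apply: eq_bigr => j _; congr (_ * _); rewrite mxE.
apply: (@lebesgue_tuple_hyperplane _ _ (fun j => (A *m Q) i j)
  (b i 0 - (A *m p) i 0)).
  by move=> u /EA <-; rewrite coordE addrC addKr.
have [|a0] := pselect (exists j, (A *m Q) i j != 0); first by left.
(* With zero coefficients the row is constant in [u], and its failure at [u0] makes it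
   inconsistent. *)
right; apply: contra Ai => /eqP H; rewrite coordE big1 ?addr0.
  by rewrite eq_sym -subr_eq0 H.
move=> j _; have [->|aj] := eqVneq ((A *m Q) i j) 0; first by rewrite mul0r.
by case: a0; exists j.
Qed.

Lemma subset_affine_hull (R : realType) (n : nat) (S : set 'cV[R]_n) :
  S `<=` affine_hull S.
Proof.
move=> x Sx; exists 1%N, (fun=> x), (fun=> 1); split=> //.
  by rewrite big_ord_recl big_ord0 addr0.
by rewrite big_ord_recl big_ord0 addr0 scale1r.
Qed.

Lemma measurable_affine_subspace (R : realType) (m n : nat) (A : 'M[R]_(m, n))
    (b : 'cV[R]_m) :
  measurable ([set x | A *m x = b] : set (borel_cV R n)).
Proof.
have -> : [set x | A *m x = b] =
    \bigcap_(i in [set: 'I_m]) [set x : 'cV[R]_n | (A *m x) i 0 = b i 0].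
  apply/seteqP; split=> [x /= <- //|x H]; apply/colP => i; exact: H.
apply: fin_bigcap_measurable => // i _.
rewrite -[X in measurable X]setCK; apply: measurableC; apply: sub_sigma_algebra.
apply: closed_openC.
have cont : continuous (fun x : 'cV[R]_n => (A *m x) i 0).
  have -> : (fun x : 'cV[R]_n => (A *m x) i 0) =
      (fun x => \sum_j A i j * x j 0).
    by apply/funext => x; rewrite mxE.
  apply: continuous_big => [|j _]; first exact: add_continuous.
  by move=> x; apply: continuousM;
    [exact: cst_continuous | exact: coord_continuous].
apply: (@preimage_closed _ _ _ [set y | y = b i 0] _ (@closed_eq _ _)) => x _.
exact: cont.
Qed.

(** * The probability that a uniform point of [F'] solves the original system *)

Theorem proposition5p1 (R : realType) (m n k : nat)
    (A : 'M[R]_(m, n)) (b : 'cV[R]_m) (c : 'cV[R]_n) (T : 'M[R]_(k, m))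
    (vP nu delta : R) :
  feasible A b !=set0 ->
  lp_value c A b = vP%:E ->
  (k < m)%N ->
  lp_value c (T *m A) (T *m b) = (vP - nu)%:E ->
  0 < delta -> 0 <= nu <= delta ->
  full_dimensional (cone A) ->
  (forall x, lp_optimal c A b x -> (m <= nb_nonzero x)%N) ->
  let tA : 'M[R]_(1 + m, n) := col_mx c^T A in
  let tb : 'cV[R]_(1 + m) := col_mx (vP - nu)%:M b in
  let tT : 'M[R]_(1 + k, 1 + m) := block_mx 1%:M 0 0 T in
  let F' : set 'cV[R]_n := feasible (tT *m tA) (tT *m tb) in
  bounded_set F' ->
  forall (d : measure_display) (Omega : measurableType d)
    (Pr : probability Omega R) (x' : {RV Pr >-> borel_cV R n}),
  uniform_on F' (distribution Pr x') ->
  {ae Pr, forall w, tA *m (x' w : 'cV[R]_n) <> tb}.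
Proof.
move=> feas valP km valPT _ /andP[nu0 _] _ supp tA tb tT F' _.
move=> d Omega Pr x' unif.
(* The block product separates the objective level from the projected constraints. *)
have F'P x : F' x <-> feasible (T *m A) (T *m b) x /\ objective c x = vP - nu.
  have tTE : tT *m (tA *m x) = col_mx (c^T *m x) (T *m A *m x).
    rewrite /tT /tA [col_mx c^T A *m x]mul_col_mx mul_block_col.
    by rewrite !mul0mx mul1mx addr0 add0r mulmxA.
  have tbE : tT *m tb = col_mx (vP - nu)%:M (T *m b).
    by rewrite /tT /tb mul_block_col !mul0mx mul1mx addr0 add0r.
  rewrite /F' /feasible /= -mulmxA tTE tbE; split.
    move=> [/eq_col_mx[cx TAx] x0]; split=> //.
    by rewrite /objective cx mxE eqxx.
  move=> [[TAx x0] cx]; split=> //; rewrite TAx; congr col_mx.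
  by rewrite [LHS]mx11_scalar -cx.
pose E := [set x : 'cV[R]_n | tA *m x = tb].
have mE : measurable (E : set (borel_cV R n)).
  exact: measurable_affine_subspace.
have [e [p [Q [_ hullE muE]]]] := unif.
have EP x : E x -> c^T *m x = (vP - nu)%:M /\ A *m x = b.
  by rewrite /E /= /tA /tb mul_col_mx => /eq_col_mx.
have E0 : affine_lebesgue p Q (E `&` F') = 0%E.
  have [EF'0|/set0P[x [Ex F'x]]] := eqVneq (E `&` F') set0.
    (* The empty set is cut out by the equation [0 = 1]. *)
    apply: (@lebesgue_tuple_hyperplane _ _ (fun=> 0) 1).
      by move=> u; rewrite EF'0.
    by right; rewrite oner_neq0.
  have [cx Ax] := EP _ Ex.
  have xf : feasible A b x by split=> //; exact: F'x.2.
  have ox : objective c x = vP - nu by rewrite /objective cx mxE eqxx.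
  (* A feasible point of the original program with objective [vP - nu] forces [nu <= 0]. *)
  have nu_0 : nu = 0.
    apply/eqP; rewrite eq_le nu0 andbT.
    have := lp_value_lb valP xf.
    by rewrite ox -subr_ge0 addrAC subrr add0r oppr_ge0.
  have [] := @projected_optimal_off_original _ _ _ _ _ _ _ T vP km valP _ supp
    _ xf.
  - by rewrite valPT nu_0 subr0.
  - by rewrite ox nu_0 subr0.
  move=> y [yf cy Ay].
  apply: (@affine_lebesgue_proper _ _ _ _ _ _ A b); first by move=> z [/EP[]].
  exists y => //; rewrite -hullE; apply: subset_affine_hull.
  by apply/F'P; rewrite nu_0 subr0.
exists (x' @^-1` E); split.
- by rewrite -[X in measurable X]setTI; exact: measurable_funPT.
(* The numerator is 0, and [0 * y = 0] in [\bar R] whatever the normalizing factor. *)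
- by have := muE E mE; rewrite E0 mul0e.
- by move=> w /= /contrapT.
Qed.
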